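(* Let $u$ be a law invariant coherent utility on $L^0$ with determining set $\mathcal{D}$ that is finite on Gaussian random variables. Let $F=(F^1,\dots,F^M)$ be a random vector with $F^m\in L^1_w(\mathcal{D})$ for all $m$, and assume $u(\langle b,F\rangle)<0$ for every $b\in\mathbb{R}^M\setminus\{0\}$. For $n\in\mathbb{N}$ let $$X_n=B_nF+\xi_n,$$ where $B_n$ is a real $n\times M$ matrix with entries $B_n^{km}$, and $\xi_n=(\xi_n^1,\dots,\xi_n^n)$ where $\xi_n^1,\dots,\xi_n^n,F$ are independent and $\xi_n^k$ is Gaussian with mean $0$ and variance $(\sigma_n^k)^2$; write $X_n=(X_n^1,\dots,X_n^n)$. Assume there exist a sequence $a_n\to\infty$ and $b=(b^1,\dots,b^M)\ne0$ such that $$a_n^{-1}\sum_{k=1}^nB_n^{km}\xrightarrow[n\to\infty]{}b^m,\quad m=1,\dots,M,\qquad a_n^{-2}\sum_{k=1}^n(\sigma_n^k)^2\xrightarrow[n\to\infty]{}0.$$ Then $$\frac{u^f\big(\sum_{k=1}^nX_n^k;F\big)}{u\big(\sum_{k=1}^nX_n^k\big)}\xrightarrow[n\to\infty]{}1.$$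
   Context: Let $(\Omega,\mathcal{F},\mathsf{P})$ be a probability space, $L^0$ the space of all real random variables, and $\mathcal{P}$ the set of probability measures on $\mathcal{F}$ absolutely continuous with respect to $\mathsf{P}$; measures $\mathsf{Q}\in\mathcal{P}$ are identified with their densities. For $\mathsf{Q}\in\mathcal{P}$ and $X\in L^0$, $\mathsf{E}_\mathsf{Q}X:=\mathsf{E}_\mathsf{Q}X^+-\mathsf{E}_\mathsf{Q}X^-$ with the convention $\infty-\infty=-\infty$. A coherent utility on $L^0$ is a map $u:L^0\to[-\infty,\infty]$ of the form $u(X)=\inf_{\mathsf{Q}\in\mathcal{D}}\mathsf{E}_\mathsf{Q}X$ for a nonempty $\mathcal{D}\subseteq\mathcal{P}$; its determining set is the largest such set, $\{\mathsf{Q}\in\mathcal{P}:\mathsf{E}_\mathsf{Q}X\ge u(X)\ \forall X\in L^0\}$. $u$ is law invariant if $u(X)=u(X')$ whenever $X,X'$ have the same distribution. $L^1_w(\mathcal{D})=\{X\in L^0:u(X)>-\infty,\ u(-X)>-\infty\}$. For a random vector $Y$, $\mathsf{E}(\mathcal{D}\mid Y):=\{\mathsf{E}(Z\mid Y):Z\in\mathcal{D}\}$ and the factor utility is $u^f(X;Y):=\inf_{\mathsf{Q}\in\mathsf{E}(\mathcal{D}\mid Y)}\mathsf{E}_\mathsf{Q}X$. *)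

(* Defs.v *)
From HB Require Import structures.
From mathcomp Require Import all_boot all_order all_algebra.
From mathcomp Require Import all_classical all_reals all_analysis.
Set Implicit Arguments. Unset Strict Implicit. Unset Printing Implicit Defensive.
Import Order.TTheory GRing.Theory Num.Theory.
Import numFieldNormedType.Exports.
Local Open Scope classical_set_scope.
Local Open Scope ring_scope.

Section Defs.
Context {d : measure_display} {Omega : measurableType d} {R : realType}.
Variable P : probability Omega R.

Definition rv (X : Omega -> R) := measurable_fun setT X.

(* P-absolutely continuous probability measures, identified with densities *)
Definition density (Z : Omega -> R) :=
  [/\ measurable_fun setT Z, (forall w, 0 <= Z w) &
      (\int[P]_w (Z w)%:E = 1)%E].

(* E_Q X := E_Q X^+ - E_Q X^-, with the convention oo - oo = -oo
   (this is exactly MathComp's convention: +oo + -oo = -oo). *)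
Definition EQ (Z X : Omega -> R) : \bar R :=
  (\int[P]_w (Z w * Num.max (X w) 0)%:E
   - \int[P]_w (Z w * Num.max (- X w) 0)%:E)%E.

Definition inf_over (D : set (Omega -> R)) (X : Omega -> R) : \bar R :=
  ereal_inf [set EQ Z X | Z in D].

Definition coherent_utility (u : (Omega -> R) -> \bar R) :=
  exists D : set (Omega -> R),
    [/\ D `<=` density, D !=set0 & forall X, rv X -> u X = inf_over D X].

(* determining set: the largest such set *)
Definition determining_set (u : (Omega -> R) -> \bar R) : set (Omega -> R) :=
  [set Z | density Z /\ forall X, rv X -> (u X <= EQ Z X)%E].

Definition same_law (X X' : Omega -> R) :=
  forall A : set R, measurable A -> P (X @^-1` A) = P (X' @^-1` A).

Definition law_invariant (u : (Omega -> R) -> \bar R) :=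
  forall X X', rv X -> rv X' -> same_law X X' -> u X = u X'.

Definition gaussian (X : Omega -> R) (m s : R) :=
  rv X /\ forall A : set R, measurable A ->
    P (X @^-1` A) = (if s == 0 then \d_m A else normal_prob m s A).

Definition finite_on_gaussians (u : (Omega -> R) -> \bar R) :=
  forall X m s, gaussian X m s -> u X \is a fin_num.

Definition L1w (u : (Omega -> R) -> \bar R) (X : Omega -> R) :=
  rv X /\ (-oo < u X)%E /\ (-oo < u (fun w => (- X w)%R))%E.

Definition sigma_of {M : nat} (F : 'I_M -> Omega -> R) : set (set Omega) :=
  <<s [set E | exists m A, measurable A /\ E = F m @^-1` A] >>.

Definition cond_exp {M : nat} (F : 'I_M -> Omega -> R) (Z W : Omega -> R) :=
  [/\ (forall B : set R, measurable B -> sigma_of F (W @^-1` B)),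
      P.-integrable setT (EFin \o W) &
      forall E, sigma_of F E ->
        (\int[P]_(w in E) (W w)%:E = \int[P]_(w in E) (Z w)%:E)%E].

Definition cond_set {M : nat} (D : set (Omega -> R)) (F : 'I_M -> Omega -> R) :=
  [set W | density W /\ exists2 Z, D Z & cond_exp F Z W].

Definition factor_utility (u : (Omega -> R) -> \bar R) {M : nat}
  (F : 'I_M -> Omega -> R) (X : Omega -> R) : \bar R :=
  inf_over (cond_set (determining_set u) F) X.

Definition indep_family_vec {M : nat} (n : nat) (xi : nat -> Omega -> R)
  (F : 'I_M -> Omega -> R) :=
  forall (E : set Omega) (A : nat -> set R),
    sigma_of F E -> (forall k, (k < n)%N -> measurable (A k)) ->
    P (E `&` \bigcap_(k in [set k | (k < n)%N]) (xi k @^-1` A k))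
    = (P E * \prod_(k < n) P (xi k @^-1` A k))%E.

End Defs.

(* Main.v *)
Require Import Defs.
From HB Require Import structures.
From mathcomp Require Import all_boot all_order all_algebra.
From mathcomp Require Import all_classical all_reals all_analysis.
From mathcomp Require Import measurable_realfun ring lra.
Import Order.TTheory GRing.Theory Num.Theory.
Import numFieldNormedType.Exports.
Local Open Scope classical_set_scope.
Local Open Scope ring_scope.

(** Write [S n = <beta n, F> + eta n], where [eta n] is the sum of the noises, a
    centred Gaussian of variance [s n ^+ 2]. On the determining set the means
    [E_Q (F m)] are bounded by constants, and law invariance together with
    homogeneity gives [|E_Q (eta n)| <= g * s n], where [g] only depends on the
    value of [u] at the standard Gaussian law. Under the conditional densities
    [E(Z | F)] the means of [F] are unchanged and [eta n] has mean [0], since it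
    is independent of [F]. Hence all means of [S n], under either family, are
    within [o(a n)] of [a n] times the mean of [<b, F>], uniformly; taking
    infima, both utilities of [S n] divided by [a n] tend to [u(<b, F>)], which
    is finite and negative. *)

Set Implicit Arguments.
Unset Strict Implicit.

(** For the infima of the means of [<b, F>] to agree over both families, every density [Z] must also
    possess a conditional expectation that is again a density; Radon-Nikodym on the sigma-algebra of
    [F] supplies it. Bounding the noises one at a time over the determining set would give [g] times
    a sum of standard deviations, whereas the assumption controls the sum of variances. Law
    invariance is therefore applied to the whole noise [eta n], which requires the law of a sum of
    independent Gaussians. Variances may vanish, so the Dirac case is carried along. *)

Section weighted_transfer.
Local Open Scope ereal_scope.
Import HBNNSimple.

(** * Transfer of weighted integrals along measurable maps *)

Section approximation.
Context d d' (T : measurableType d) (T' : measurableType d') (R : realType).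
Variables (mu : {measure set T -> \bar R}) (phi : T -> T') (g : T -> R).
Variables (f : T' -> \bar R).
Hypotheses (mphi : measurable_fun setT phi) (mg : measurable_fun setT g).
Hypotheses (g0 : forall x, (0 <= g x)%R).
Hypotheses (mf : measurable_fun setT f) (f0 : forall x, 0 <= f x).

Let a := nnsfun_approx measurableT mf.

(** The simple functions [a n] depend on [f] alone, so the right-hand side sees [mu], [phi] and [g]
    only through the integrals of [g] over preimages under [phi]. Monotone convergence gives the
    equality. *)
Lemma integral_comp_weight_approx : \int[mu]_x (f (phi x) * (g x)%:E) =
  limn (fun n => \sum_(k \in range (a n))
    k%:E * \int[mu]_(x in phi @^-1` (a n @^-1` [set k])) (g x)%:E).
Proof.
have mpre n k : measurable (phi @^-1` (a n @^-1` [set k])).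
  by rewrite -[X in measurable X]setTI; exact: mphi.
have man n : measurable_fun setT (fun x => a n (phi x)).
  by apply: measurableT_comp => //; exact: measurable_funP.
transitivity (limn (fun n => \int[mu]_x ((a n (phi x))%:E * (g x)%:E))).
  rewrite -monotone_convergence//.
  - apply: eq_integral => x _; apply/esym/cvg_lim => //.
    by apply: cvgeZr => //; exact: cvg_nnsfun_approx.
  - by move=> n; apply: emeasurable_funM; exact/measurable_EFinP.
  - by move=> n x _; rewrite mule_ge0// lee_fin.
  - move=> x _ m n mn; rewrite lee_wpmul2r ?lee_fin//.
    exact/lefP/nd_nnsfun_approx.
congr (limn _); apply/funext => n.
transitivity (\int[mu]_x (\sum_(k \in range (a n))
    (k%:E * ((\1_(a n @^-1` [set k]) (phi x))%:E * (g x)%:E)))).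
  apply: eq_integral => x _; rewrite fimfunE -fsumEFin// ge0_mule_fsuml//.
    by apply: eq_fsbigr => k _; rewrite EFinM muleA.
  by move=> k; rewrite EFinM nnfun_muleindic_ge0.
rewrite ge0_integral_fsum//.
- apply: eq_fsbigr => k; rewrite inE => -[y _ <-].
  rewrite ge0_integralZl//; last 3 first.
  + apply: emeasurable_funM; apply/measurable_EFinP => //.
    by apply: measurableT_comp => //.
  + by move=> x _; rewrite mule_ge0// lee_fin.
  + by rewrite lee_fin.
  congr (_ * _); rewrite [RHS]integral_mkcond; apply: eq_integral => x _.
  rewrite patchE indicE.
  rewrite (_ : (phi x \in _) = (x \in phi @^-1` (a n @^-1` [set a n y]))) //.
  case: (_ \in _); first by rewrite mul1e.
  by rewrite mul0e.
- move=> k; apply: measurable_funeM; apply: emeasurable_funM.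
  + by apply/measurable_EFinP; apply: measurableT_comp.
  + exact/measurable_EFinP.
- move=> k x _; rewrite muleA; apply: mule_ge0; last by rewrite lee_fin.
  exact: nnfun_muleindic_ge0.
Qed.

End approximation.

(** One principle for several uses: change of density ([phi] the identity), equality in law (weights
    1), and conditional expectation ([T'] the same space with a smaller sigma-algebra). *)
Lemma eq_integral_comp_weight d1 d2 d' (T1 : measurableType d1)
    (T2 : measurableType d2) (T' : measurableType d') (R : realType)
    (mu1 : {measure set T1 -> \bar R}) (mu2 : {measure set T2 -> \bar R})
    (phi1 : T1 -> T') (phi2 : T2 -> T') (g1 : T1 -> R) (g2 : T2 -> R)
    (f : T' -> \bar R) :
  measurable_fun setT phi1 -> measurable_fun setT phi2 ->
  measurable_fun setT g1 -> measurable_fun setT g2 ->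
  (forall x, 0 <= g1 x)%R -> (forall x, 0 <= g2 x)%R ->
  (forall E, measurable E -> \int[mu1]_(x in phi1 @^-1` E) (g1 x)%:E =
                             \int[mu2]_(x in phi2 @^-1` E) (g2 x)%:E) ->
  measurable_fun setT f -> (forall x, 0 <= f x) ->
  \int[mu1]_x (f (phi1 x) * (g1 x)%:E) = \int[mu2]_x (f (phi2 x) * (g2 x)%:E).
Proof.
move=> mphi1 mphi2 mg1 mg2 g10 g20 eqg mf f0.
rewrite (integral_comp_weight_approx mu1 mphi1 mg1 g10 mf f0).
rewrite (integral_comp_weight_approx mu2 mphi2 mg2 g20 mf f0).
congr (limn _); apply/funext => n; apply: eq_fsbigr => k _.
by rewrite eqg.
Qed.

Lemma integral_density d (T : measurableType d) (R : realType)
    (mu nu : {measure set T -> \bar R}) (g : T -> R) (f : T -> \bar R) :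
  measurable_fun setT g -> (forall x, 0 <= g x)%R ->
  (forall E, measurable E -> nu E = \int[mu]_(x in E) (g x)%:E) ->
  measurable_fun setT f -> (forall x, 0 <= f x) ->
  \int[nu]_x f x = \int[mu]_x (f x * (g x)%:E).
Proof.
move=> mg g0 nuE mf f0.
rewrite -(@eq_integral_comp_weight _ _ _ _ _ _ _ nu mu id id (cst 1%R))//=.
  by apply: eq_integral => x _; rewrite mule1.
by move=> E mE; rewrite preimage_id integral_cst// mul1e nuE.
Qed.

Lemma eq_integral_same_law d (T : measurableType d) (R : realType)
    (P : probability T R) (X Y : T -> R) (f : R -> \bar R) :
  measurable_fun setT X -> measurable_fun setT Y -> same_law P X Y ->
  measurable_fun setT f -> (forall x, 0 <= f x) ->
  \int[P]_x f (X x) = \int[P]_x f (Y x).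
Proof.
move=> mX mY XY mf f0.
have := @eq_integral_comp_weight _ _ _ _ _ _ _ P P X Y (cst 1%R) (cst 1%R) f.
move=> /(_ mX mY) H.
transitivity (\int[P]_x (f (X x) * (cst 1%R x)%:E)).
  by apply: eq_integral => x _; rewrite mule1.
rewrite H//.
  by apply: eq_integral => x _; rewrite mule1.
move=> E mE; rewrite /= !integral_cst ?mul1e; first exact: XY.
- by rewrite -[X in measurable X]setTI; exact: mY.
- by rewrite -[X in measurable X]setTI; exact: mX.
Qed.

End weighted_transfer.

Section image_measure.
Context d d' (T1 : measurableType d) (T2 : measurableType d') (R : realType).
Variable f : T1 -> T2.

(* Unlike [pushforward], it carries the measurability of [f], so that its
   measure structure is inferred without leaving a side condition. *)
Definition image_measure (m : set T1 -> \bar R) of measurable_fun setT f :=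
  pushforward m f.

Hypothesis mf : measurable_fun setT f.

Section measure.
Variable m : {measure set T1 -> \bar R}.
HB.instance Definition _ := Measure.copy (image_measure m mf)
  (measure_function_pushforward__canonical__measure_function_Measure m mf).
End measure.

Section finite_measure.
Variable m : {finite_measure set T1 -> \bar R}.

Let fin_num_image_measure : fin_num_fun (image_measure m mf).
Proof.
move=> A mA; apply: fin_num_measure.
by rewrite -[X in measurable X]setTI; exact: mf.
Qed.

HB.instance Definition _ := Measure_isFinite.Build _ _ _ (image_measure m mf)
  fin_num_image_measure.
End finite_measure.

End image_measure.

(** * Normal densities: affine maps, symmetry, products *)

Section normal_affine.
Context {R : realType}.
Local Notation mu := (@lebesgue_measure R).

Lemma measurable_affine (c e : R) :
  measurable_fun setT (fun x : measurableTypeR R => c * x + e : measurableTypeR R).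
Proof. by apply: measurable_funD => //; exact: measurable_funM. Qed.

(** The image of Lebesgue measure, scaled by [c], gives half-open intervals their length, so
    uniqueness of Lebesgue measure applies. *)
Lemma lebesgue_measure_affine (c e : R) (A : set R) : 0 < c -> measurable A ->
  mu ((fun x => c * x + e) @^-1` A) = (c^-1%:E * mu A)%E.
Proof.
move=> c0 mA.
have c0' : 0 <= c by exact: ltW.
pose k := NngNum c0'.
suff : mu A = mscale k (image_measure mu (measurable_affine c e)) A.
  rewrite -[X in _ = X -> _]/(c%:E * mu ((fun x => c * x + e)%R @^-1` A))%E => ->.
  by rewrite muleA -EFinM mulVf ?gt_eqF// mul1e.
apply: lebesgue_measure_unique => // _ [[a b]] _ <-.
rewrite -[RHS]/(c%:E * mu ((fun x => c * x + e)%R @^-1` `]a, b]))%E.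
rewrite (_ : _ @^-1` _ = `](a - e) / c, (b - e) / c]%classic); last first.
  apply/seteqP; split => x /=; rewrite !in_itv/=.
    by rewrite ltr_pdivrMr// ler_pdivlMr// ltrBlDr lerBrDr [x * c]mulrC.
  by rewrite ltr_pdivrMr// ler_pdivlMr// ltrBlDr lerBrDr [x * c]mulrC.
rewrite !lebesgue_measure_itv/= !lte_fin ltr_pM2r ?invr_gt0// ltrD2r.
case: ifPn => _; last by rewrite mule0.
rewrite -!EFinB -EFinM; congr EFin; field.
by rewrite gt_eqF.
Qed.

Lemma normal_pdf_affine (c e m s x : R) : 0 < c -> s != 0 ->
  normal_pdf (c * m + e) (c * s) (c * x + e) = c^-1 * normal_pdf m s x.
Proof.
move=> c0 s0; have cn0 : c != 0 by rewrite gt_eqF.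
rewrite !normal_pdfE ?mulf_neq0// mulrA; congr (_ * _).
  rewrite /normal_peak -invfM; congr (_^-1).
  rewrite exprMn -mulrA -mulrnAr sqrtrM ?sqr_ge0// sqrtr_sqr.
  by rewrite gtr0_norm// mulrC.
rewrite /normal_fun; congr expR; field.
by rewrite s0 cn0.
Qed.

Lemma normal_prob_affine (c e m s : R) (A : set R) : 0 < c -> s != 0 ->
  measurable A ->
  normal_prob m s ((fun x => c * x + e) @^-1` A) =
  normal_prob (c * m + e) (c * s) A.
Proof.
move=> c0 s0 mA; rewrite /normal_prob.
have c0' : 0 <= c by exact: ltW.
pose k := NngNum c0'.
have mpdf m' s' : measurable_fun setT (fun x : R => (normal_pdf m' s' x)%:E).
  by apply/measurable_EFinP; exact: measurable_normal_pdf.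
rewrite [RHS](eq_measure_integral (mscale k (image_measure mu (measurable_affine c e)))); last first.
  move=> B mB _; rewrite -[RHS]/(c%:E * mu ((fun x => c * x + e)%R @^-1` B))%E lebesgue_measure_affine//.
  by rewrite muleA -EFinM mulfV ?gt_eqF// mul1e.
rewrite ge0_integral_mscale//; last 2 first.
- by apply: measurable_funTS; exact: mpdf.
- by move=> x _; rewrite lee_fin normal_pdf_ge0.
rewrite ge0_integral_pushforward//; last 3 first.
- exact: measurable_affine.
- by apply: measurable_funTS; exact: mpdf.
- by move=> x _; rewrite lee_fin normal_pdf_ge0.
under [in RHS]eq_integral do rewrite /= normal_pdf_affine// EFinM.
rewrite ge0_integralZl//.
- by rewrite muleA -EFinM/= mulfV ?gt_eqF// mul1e.
- by rewrite -[X in measurable X]setTI; exact: measurable_affine.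
- by apply: measurable_funTS; exact: mpdf.
- by move=> x _; rewrite lee_fin normal_pdf_ge0.
- by rewrite lee_fin invr_ge0.
Qed.

Lemma normal_probN (s : R) (A : set R) : s != 0 -> measurable A ->
  normal_prob 0 s (-%R @^-1` A) = normal_prob 0 s A.
Proof.
move=> s0 mA; rewrite /normal_prob.
have mpdf m' s' : measurable_fun setT (fun x : R => (normal_pdf m' s' x)%:E).
  by apply/measurable_EFinP; exact: measurable_normal_pdf.
rewrite [RHS](eq_measure_integral
    (pushforward mu (-%R : measurableTypeR R -> measurableTypeR R))); last first.
  by move=> B mB _; exact/esym/lebesgue_measureN.
rewrite ge0_integral_pushforward//; last 2 first.
- by apply: measurable_funTS; exact: mpdf.
- by move=> x _; rewrite lee_fin normal_pdf_ge0.
apply: eq_integral => x _ /=; congr EFin.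
by rewrite !normal_pdfE// /normal_fun !subr0 sqrrN.
Qed.

(** Bayes' formula for a Gaussian [x] observed as [z] with Gaussian error: completing the square in
    [x] splits the joint density into the marginal of [z] and the conditional density of [x]. *)
Lemma normal_pdf_convolution (s t x z : R) : s != 0 -> t != 0 ->
  let r := Num.sqrt (s ^+ 2 + t ^+ 2) in
  normal_pdf x t z * normal_pdf 0 s x =
  normal_pdf 0 r z * normal_pdf (z * s ^+ 2 / r ^+ 2) (s * t / r) x.
Proof.
move=> s0 t0 r.
have rr : r ^+ 2 = s ^+ 2 + t ^+ 2.
  by rewrite /r sqr_sqrtr// addr_ge0 ?sqr_ge0.
have r2 : 0 < s ^+ 2 + t ^+ 2.
  by rewrite ltr_wpDr ?sqr_ge0// exprn_even_gt0.
have r0 : r != 0 by rewrite gt_eqF// sqrtr_gt0.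
rewrite !normal_pdfE ?mulf_neq0 ?invr_eq0// /normal_fun.
rewrite mulrACA [RHS]mulrACA -!expRD; congr (_ * expR _).
  have pos a : 0 <= a ^+ 2 * pi *+ 2 :> R.
    by rewrite mulrn_wge0// mulr_ge0 ?pi_ge0// sqr_ge0.
  rewrite /normal_peak -!invfM -!sqrtrM ?pos//.
  congr ((Num.sqrt _)^-1); rewrite expr_div_n exprMn; field.
  by rewrite r0.
rewrite expr_div_n exprMn rr; field.
by rewrite s0 t0 gt_eqF.
Qed.

End normal_affine.

(** * Centred Gaussian laws, degenerate ones included, and their convolution *)

Section gaussian_law.
Context {R : realType}.
Local Notation mu := (@lebesgue_measure R).
Implicit Types (s t : R) (A : set R).

(** The case split of [gaussian], made on probability measures rather than on values, so that the
    result can serve as an integrator and as a factor of a product measure. *)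
Definition gaussian_law s : probability (measurableTypeR R) R :=
  if s == 0 then (\d_(0 : measurableTypeR R) : probability _ R)
  else (normal_prob 0 s : probability _ R).

Lemma gaussian_lawE s A :
  gaussian_law s A = if s == 0 then \d_(0 : R) A else normal_prob 0 s A.
Proof. by rewrite /gaussian_law; case: ifP. Qed.

Lemma gaussian_law0 :
  gaussian_law 0 = (\d_(0 : measurableTypeR R) : probability _ R).
Proof. by rewrite /gaussian_law eqxx. Qed.

Lemma gaussian_lawE_neq0 s : s != 0 ->
  gaussian_law s = (normal_prob 0 s : probability (measurableTypeR R) R).
Proof. by move=> /negbTE s0; rewrite /gaussian_law s0. Qed.

(** The sign of [s] is unconstrained, while adding a degenerate summand produces the parameter
    [Num.sqrt (s ^+ 2)], which is the absolute value of [s]. *)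
Lemma gaussian_law_norm s A : gaussian_law `|s| A = gaussian_law s A.
Proof.
rewrite !gaussian_lawE normr_eq0; case: ifPn => // s0.
apply: eq_integral => x _; rewrite !normal_pdfE ?normr_eq0//.
by rewrite /normal_peak /normal_fun real_normK// num_real.
Qed.

Lemma measurable_normal_pdf2 t : t != 0 ->
  measurable_fun setT (fun z : measurableTypeR R * measurableTypeR R =>
    normal_pdf z.1 t z.2).
Proof.
move=> t0.
rewrite (_ : (fun z => _) = (fun z : measurableTypeR R * measurableTypeR R =>
    normal_peak t * expR (- (z.2 - z.1) ^+ 2 / (t ^+ 2 *+ 2)))).
  apply: measurable_funM => //; apply: measurableT_comp => //.
  apply: measurable_funM => //; apply: measurableT_comp => //.
  apply: measurable_funX => //; apply: measurable_funB.
    exact: measurable_snd.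
  exact: measurable_fst.
by apply/funext => z; rewrite normal_pdfE.
Qed.

Lemma measurable_normal_prob_mean t A : t != 0 -> measurable A ->
  measurable_fun setT (fun x : measurableTypeR R => normal_prob x t A).
Proof.
move=> t0 mA.
have := @measurable_fun_fubini_tonelli_F _ _ (measurableTypeR R)
  (measurableTypeR R) R mu
  (fun z => (normal_pdf z.1 t z.2)%:E * (\1_A z.2)%:E)%E.
rewrite /fubini_F => H.
rewrite (_ : (fun x => _) = (fun x : measurableTypeR R =>
  \int[mu]_y ((normal_pdf x t y)%:E * (\1_A y)%:E))%E).
  apply: H.
    apply: emeasurable_funM; apply/measurable_EFinP.
      exact: measurable_normal_pdf2.
    by apply: measurableT_comp => //; exact: measurable_snd.
  by move=> z; rewrite mule_ge0// lee_fin ?normal_pdf_ge0.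
apply/funext => x; rewrite /normal_prob integral_mkcond.
apply: eq_integral => y _; rewrite patchE indicE.
by case: (_ \in _); rewrite ?mule1 ?mule0.
Qed.

(** After Tonelli and [normal_pdf_convolution], the integral in [x] is that of a conditional density
    and equals 1, leaving the marginal of [z]. *)
Lemma normal_prob_convolution s t A : s != 0 -> t != 0 -> measurable A ->
  (\int[normal_prob 0 s]_x normal_prob x t A =
   normal_prob 0 (Num.sqrt (s ^+ 2 + t ^+ 2)) A)%E.
Proof.
move=> s0 t0 mA; set r := Num.sqrt _.
have pdf0 m u z : (0 <= (normal_pdf m u z : R)%:E)%E.
  by rewrite lee_fin normal_pdf_ge0.
have mpdf m u : measurable_fun setT (fun z => (normal_pdf m u z : R)%:E).
  by apply/measurable_EFinP; exact: measurable_normal_pdf.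
rewrite (@integral_density _ _ _ mu _ (normal_pdf 0 s))//; last 3 first.
- exact: measurable_normal_pdf.
- by move=> x; exact: normal_pdf_ge0.
- exact: measurable_normal_prob_mean.
pose h (z : measurableTypeR R * measurableTypeR R) :=
  ((normal_pdf z.1 t z.2 * \1_A z.2)%:E * (normal_pdf 0 s z.1)%:E)%E.
have h0 z : (0 <= h z)%E.
  by rewrite mule_ge0// lee_fin mulr_ge0 ?normal_pdf_ge0.
transitivity (\int[mu]_x \int[mu]_y h (x, y))%E.
  apply: eq_integral => x _; rewrite /h/= ge0_integralZr//; last 2 first.
  - apply/measurable_EFinP/measurable_funM => //.
    exact: measurable_normal_pdf.
  - by move=> y _; rewrite lee_fin mulr_ge0 ?normal_pdf_ge0.
  congr (_ * _)%E; rewrite /normal_prob [LHS]integral_mkcond.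
  apply: eq_integral => y _; rewrite patchE indicE.
  by case: (_ \in _); rewrite ?mulr1 ?mulr0.
rewrite fubini_tonelli//; last first.
  apply: emeasurable_funM; apply/measurable_EFinP.
    apply: measurable_funM; first exact: measurable_normal_pdf2.
    by apply: measurableT_comp => //; exact: measurable_snd.
  apply: measurableT_comp; first exact: measurable_normal_pdf.
  exact: measurable_fst.
rewrite /normal_prob [RHS]integral_mkcond; apply: eq_integral => z _.
transitivity (\int[mu]_x ((\1_A z * normal_pdf 0 r z)%:E *
    (normal_pdf (z * s ^+ 2 / r ^+ 2) (s * t / r) x)%:E))%E.
  apply: eq_integral => x _; rewrite /h/= -!EFinM; congr EFin.
  by rewrite mulrAC normal_pdf_convolution// -/r; ring.
rewrite ge0_integralZl//; last 2 first.
- exact: mpdf.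
- by rewrite lee_fin mulr_ge0 ?normal_pdf_ge0.
rewrite integral_normal_pdf mule1 patchE indicE.
by case: (_ \in _); rewrite ?mul1r ?mul0r.
Qed.

Lemma measurable_add_preimage A : measurable A ->
  measurable ((fun z : measurableTypeR R * measurableTypeR R =>
    z.1 + z.2) @^-1` A).
Proof.
move=> mA; rewrite -[X in measurable X]setTI.
suff : measurable_fun setT (fun z : measurableTypeR R * measurableTypeR R =>
    z.1 + z.2) by exact.
by apply: measurable_funD; [exact: measurable_fst|exact: measurable_snd].
Qed.

Lemma xsection_add_preimage A (x : R) :
  xsection ((fun z : measurableTypeR R * measurableTypeR R =>
    z.1 + z.2) @^-1` A) x = (fun y => x + y) @^-1` A.
Proof. by apply/seteqP; split => y; rewrite /xsection/= inE. Qed.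

Lemma gaussian_law_convolution s t A : measurable A ->
  (\int[gaussian_law s]_x gaussian_law t ((fun y => x + y)%R @^-1` A) =
   gaussian_law (Num.sqrt (s ^+ 2 + t ^+ 2))%R A)%E.
Proof.
move=> mA.
have mpre x : measurable ((fun y : R => x + y) @^-1` A).
  by rewrite -[X in measurable X]setTI; exact: measurable_funD.
have [->|s0] := eqVneq s 0.
  rewrite gaussian_law0 expr0n add0r sqrtr_sqr gaussian_law_norm.
  rewrite integral_dirac//.
    rewrite /dirac/= indicT mul1e; congr (gaussian_law t _).
    by apply/seteqP; split => y /=; rewrite add0r.
  have := @measurable_fun_xsection _ _ (measurableTypeR R) (measurableTypeR R) R
    (gaussian_law t) _ (measurable_add_preimage mA).
  by congr (measurable_fun _ _); apply/funext => x/=; rewrite xsection_add_preimage.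
have [->|t0] := eqVneq t 0.
  rewrite gaussian_law0 expr0n addr0 sqrtr_sqr gaussian_law_norm.
  rewrite -[RHS]mul1e -integral_cst// [RHS]integral_mkcond.
  apply: eq_integral => x _; rewrite patchE /= diracE.
  rewrite (_ : (0 \in _) = (x \in A)); first by case: (_ \in _).
  by apply/idP/idP; rewrite !inE /= addr0.
have r0 : Num.sqrt (s ^+ 2 + t ^+ 2) != 0.
  by rewrite gt_eqF// sqrtr_gt0 ltr_wpDr ?sqr_ge0// exprn_even_gt0.
rewrite gaussian_lawE_neq0// (gaussian_lawE _ A) (negbTE r0) -normal_prob_convolution//.
apply: eq_integral => x _. rewrite gaussian_lawE_neq0//.
have := @normal_prob_affine _ 1 x 0 t A ltr01 t0 mA.
rewrite mulr0 add0r mul1r => <-; congr (normal_prob 0 t _).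
by apply/seteqP; split => y /=; rewrite mul1r addrC.
Qed.

End gaussian_law.

(** * Sums of independent Gaussian variables *)

Section sum_of_gaussians.
Context d (T : measurableType d) (R : realType) (P : probability T R).

Lemma gaussianP (X : T -> R) s : gaussian P X 0 s <->
  rv X /\ forall A, measurable A -> P (X @^-1` A) = gaussian_law s A.
Proof.
by split=> -[mX lawX]; split => // A mA; rewrite lawX// gaussian_lawE.
Qed.

(* [C] stands for the events of the variables that are not summed yet, so that
   the statement can be iterated. *)
Lemma gaussian_law_add (X Y : T -> R) (C : set T) s t :
  measurable_fun setT X -> measurable_fun setT Y -> measurable C ->
  (forall A B, measurable A -> measurable B ->
    P (X @^-1` A `&` (Y @^-1` B `&` C)) =
      (gaussian_law s A * (gaussian_law t B * P C))%E) ->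
  forall A, measurable A -> P ((X \+ Y) @^-1` A `&` C) =
    (gaussian_law (Num.sqrt (s ^+ 2 + t ^+ 2))%R A * P C)%E.
Proof.
move=> mX mY mC XYC A mA.
have XC B : measurable B -> P (X @^-1` B `&` C) = (gaussian_law s B * P C)%E.
  move=> mB; have := XYC B setT mB measurableT.
  by rewrite preimage_setT setTI probability_setT mul1e.
pose D := (fun z : measurableTypeR R * measurableTypeR R => z.1 + z.2) @^-1` A.
have mD : measurable D by exact: measurable_add_preimage.
have mX' : measurable_fun setT (X : T -> measurableTypeR R) by [].
have mY' : measurable_fun setT (Y : T -> measurableTypeR R) by [].
(* With [P] restricted to [C], the factor [P C] becomes the total mass of [m1], and the hypothesis
   says that the joint image of [X] and [Y] is the product of [m1] and [gaussian_law t]. *)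
pose m1 := image_measure (mrestr P mC) mX'.
pose m' := image_measure (mrestr P mC) (measurable_fun_pair mX' mY').
transitivity ((m1 \x gaussian_law t)%E D).
  apply/esym; rewrite -[RHS]/(m' D); apply: product_measure_unique => //.
  move=> B E mB mE.
  rewrite -[LHS]/(P ((X @^-1` B `&` Y @^-1` E) `&` C)).
  rewrite -[X in (X * _)%E]/(P (X @^-1` B `&` C)) -setIA XYC// XC//.
  by rewrite -muleA [(P C * _)%E]muleC.
rewrite /product_measure1.
have c0 : 0 <= fine (P C) by rewrite fine_ge0.
pose k := NngNum c0.
rewrite (eq_measure_integral (mscale k (gaussian_law s))); last first.
  move=> B mB _; rewrite -[LHS]/(P (X @^-1` B `&` C)) XC//.
  by rewrite -[RHS]/((fine (P C))%:E * gaussian_law s B)%E fineK ?fin_num_measure// muleC.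
rewrite ge0_integral_mscale//; last exact: measurable_fun_xsection.
rewrite -[(k%:num)%:E]/((fine (P C))%:E) fineK ?fin_num_measure// muleC.
congr (_ * _)%E; rewrite -gaussian_law_convolution//.
by apply: eq_integral => x _ /=; rewrite xsection_add_preimage.
Qed.

Lemma gaussian_sum n (xi : nat -> T -> R) (sigma : nat -> R) :
  (forall k, (k < n)%N -> gaussian P (xi k) 0 (sigma k)) ->
  (forall A : nat -> set R, (forall k, (k < n)%N -> measurable (A k)) ->
    P (\bigcap_(k in [set k | (k < n)%N]) (xi k @^-1` A k))
    = (\prod_(k < n) P (xi k @^-1` A k))%E) ->
  gaussian P (fun w => \sum_(k < n) xi k w) 0
    (Num.sqrt (\sum_(k < n) sigma k ^+ 2)).
Proof.
move=> gxi indep.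
have mxi k : (k < n)%N -> measurable_fun setT (xi k) by move=> /gxi[].
have mpre k B : (k < n)%N -> measurable B -> measurable (xi k @^-1` B).
  by move=> kn mB; rewrite -[X in measurable X]setTI; exact: mxi.
(* The first [j] variables are summed and the others keep arbitrary events, which preserves their
   joint independence for the next addition. At [j = 0] the empty sum is constant, with law
   [gaussian_law 0]. *)
have step j : (j <= n)%N -> forall A (B : nat -> set R), measurable A ->
    (forall k, (k < n)%N -> measurable (B k)) ->
  P ((fun w => \sum_(k < j) xi k w) @^-1` A `&`
     \bigcap_(k in [set k | (j <= k < n)%N]) (xi k @^-1` B k)) =
  (gaussian_law (Num.sqrt (\sum_(k < j) sigma k ^+ 2))%R A *
   \prod_(j <= k < n) P (xi k @^-1` B k))%E.
  elim: j => [|j IH] jn A B mA mB.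
    rewrite big_ord0 sqrtr0 gaussian_law0 /= diracE.
    rewrite big_mkord -indep//.
    under [X in X @^-1` _]eq_fun do rewrite big_ord0.
    rewrite preimage_cst; case: ifPn => A0; first by rewrite setTI mul1e.
    by rewrite set0I measure0 mul0e.
  pose C := \bigcap_(k in [set k | (j.+1 <= k < n)%N]) (xi k @^-1` B k).
  (* Prescribes the event of [xi j] separately, so that the induction hypothesis takes the form
     required by [gaussian_law_add]. *)
  pose cons B0 k := if k == j then B0 : set R else B k.
  have mcons B0 : measurable B0 -> forall k, (k < n)%N -> measurable (cons B0 k).
    by move=> mB0 k kn; rewrite /cons; case: ifP => // _; exact: mB.
  have capC B0 : \bigcap_(k in [set k | (j <= k < n)%N]) (xi k @^-1` cons B0 k) =
      xi j @^-1` B0 `&` C.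
    apply/seteqP; split => [w Bw|w [Bw Cw] k /= /andP[jk kn]].
      split; first by have := Bw j; rewrite /= leqnn jn /cons eqxx; exact.
      move=> k /= /andP[jk kn]; have := Bw k; rewrite /= (ltnW jk) kn /cons gtn_eqF//.
      exact.
    rewrite /cons; case: eqVneq => [->//|kj].
    by apply: Cw => /=; rewrite kn ltn_neqAle eq_sym kj jk.
  have prodC B0 : (\prod_(j <= k < n) P (xi k @^-1` cons B0 k) =
      P (xi j @^-1` B0) * \prod_(j.+1 <= k < n) P (xi k @^-1` B k))%E.
    rewrite big_ltn// /cons eqxx; congr (_ * _)%E.
    by apply: eq_big_nat => k /andP[jk _]; rewrite gtn_eqF.
  have {}IH A' B0 : measurable A' -> measurable B0 ->
    P ((fun w => \sum_(k < j) xi k w) @^-1` A' `&` (xi j @^-1` B0 `&` C)) =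
    (gaussian_law (Num.sqrt (\sum_(k < j) sigma k ^+ 2))%R A' *
     (P (xi j @^-1` B0) * \prod_(j.+1 <= k < n) P (xi k @^-1` B k)))%E.
    by move=> mA' mB0; rewrite -capC IH// ?prodC// 1?ltnW//; exact: mcons.
  have PC : P C = (\prod_(j.+1 <= k < n) P (xi k @^-1` B k))%E.
    have := IH setT setT measurableT measurableT.
    by rewrite !preimage_setT !setTI !probability_setT !mul1e.
  have mC : measurable C.
    apply: bigcap_measurableType => k /andP[_ kn].
    by apply: mpre => //; exact: mB.
  rewrite -PC big_ord_recr/=.
  rewrite (_ : (fun w => _) = (fun w => \sum_(k < j) xi k w) \+ xi j); last first.
    by apply/funext => w; rewrite big_ord_recr.
  rewrite -[X in X + sigma j ^+ 2]sqr_sqrtr; last first.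
    by rewrite sumr_ge0// => k _; exact: sqr_ge0.
  apply: gaussian_law_add => //.
  - by apply: measurable_sum => k; apply: mxi; rewrite (ltn_trans (ltn_ord k)).
  - exact: mxi.
  - move=> A' B0 mA' mB0; rewrite IH// PC.
    by have /gaussianP[_ ->] := gxi _ jn.
apply/gaussianP; split.
  by apply: measurable_sum => k; exact: mxi.
move=> A mA; have := step n (leqnn _) A (fun=> setT) mA (fun _ _ => measurableT).
rewrite big_geq// mule1 => <-; congr (P _); apply/esym/setIidPl => w _ k /=.
by case/andP => nk kn; rewrite ltnNge nk in kn.
Qed.

End sum_of_gaussians.

(** * First moments of Gaussian variables *)

Section gaussian_moment.
Context d (T : measurableType d) (R : realType) (P : probability T R).
Implicit Types (X : T -> R) (s : R).

Lemma gaussian_normalize X s : 0 < s -> gaussian P X 0 s ->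
  gaussian P (fun w => s^-1 * X w) 0 1.
Proof.
move=> s0 [mX lawX]; split; first exact: measurable_funM.
move=> A mA; rewrite oner_eq0.
have mA' : measurable ((fun x : R => s^-1 * x + 0) @^-1` A).
  by rewrite -[X in measurable X]setTI; exact: measurable_affine.
have sV : 0 < s^-1 by rewrite invr_gt0.
have sn0 : s != 0 by rewrite gt_eqF.
transitivity (P (X @^-1` ((fun x : R => s^-1 * x + 0) @^-1` A))).
  by congr (P _); apply/seteqP; split => w /=; rewrite addr0.
rewrite lawX// (negbTE sn0) normal_prob_affine//.
by rewrite mulr0 addr0 mulVf.
Qed.

Lemma gaussianN X s : gaussian P X 0 s -> gaussian P (fun w => - X w) 0 s.
Proof.
move=> [mX lawX]; split; first exact: measurableT_comp.
move=> A mA.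
have mA' : measurable ((-%R : R -> R) @^-1` A).
  by rewrite -[X in measurable X]setTI; exact: (@oppr_measurable R setT).
rewrite -[X in P X]/(X @^-1` (-%R @^-1` A)) lawX//.
case: ifPn => s0; last exact: normal_probN.
by rewrite !diracE; congr ((nat_of_bool _)%:R%:E); apply/idP/idP; rewrite !inE /= oppr0.
Qed.

(** A majorant of total mass [2 * |s|], which gives integrability without computing the moment.
    Doubling the deviation halves the peak and gains the factor [expR y] with [y = 3/8 * (x/s)^2];
    then [1 + y <= expR y] and [t <= 1 + 3/8 * t^2] suffice. *)
Lemma normal_pdf_norm_le s x : s != 0 ->
  `|x| * normal_pdf 0 s x <= (2 * `|s|) * normal_pdf 0 (2 * s) x.
Proof.
move=> s0; rewrite !normal_pdfE ?mulf_neq0//.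
have -> : normal_peak (2 * s) = 2^-1 * normal_peak s.
  rewrite /normal_peak -invfM; congr (_^-1).
  rewrite exprMn -mulrA -mulrnAr sqrtrM ?sqr_ge0// sqrtr_sqr.
  by rewrite gtr0_norm.
rewrite [leRHS](_ : _ = normal_peak s * (`|s| * normal_fun 0 (2 * s) x)); last first.
  by field.
rewrite mulrCA ler_wpM2l ?normal_peak_ge0//.
rewrite /normal_fun !subr0.
set y := 3 / 8 * (x / s) ^+ 2.
have -> : - x ^+ 2 / ((2 * s) ^+ 2 *+ 2) = y + (- x ^+ 2 / (s ^+ 2 *+ 2)).
  by rewrite /y; field.
rewrite expRD mulrA ler_wpM2r ?expR_ge0//.
apply: (@le_trans _ _ (`|s| * (1 + y))); last first.
  by rewrite ler_wpM2l// expR_ge1Dx.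
have s0' : 0 < `|s| by rewrite normr_gt0.
rewrite mulrC -ler_pdivrMr// /y.
rewrite -[(x / s) ^+ 2](@real_normK _ (x / s)) ?num_real// normrM normfV.
move: (`|x| / `|s|) => t; have := sqr_ge0 (t - 4 / 3); nra.
Qed.

Lemma gaussian_integrable X s : gaussian P X 0 s ->
  P.-integrable setT (EFin \o X).
Proof.
move=> [mX lawX]; apply/integrableP; split; first exact/measurable_EFinP.
have mabs : measurable_fun setT (fun x : R => `|x|%:E).
  by apply/measurable_EFinP; exact: normr_measurable.
have mX' : measurable_fun setT (X : T -> measurableTypeR R) by [].
have [s0|s0] := eqVneq s 0.
  rewrite (_ : \int[P]_x _ = \int[image_measure P mX']_x (`|x|%:E))%E; last first.
    by rewrite ge0_integral_pushforward.
  rewrite (eq_measure_integral (\d_(0 : measurableTypeR R)))%R; last first.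
    by move=> A mA _; rewrite -[LHS]/(P (X @^-1` A)) lawX// s0 eqxx.
  by rewrite integral_dirac// diracT mul1e normr0 ltry.
rewrite (_ : \int[P]_x _ = \int[P]_x (`|X x|%:E * (cst 1 x)%:E))%E; last first.
  by apply: eq_integral => x _; rewrite mule1.
rewrite (@eq_integral_comp_weight _ _ _ T (measurableTypeR R) (measurableTypeR R) R
  P lebesgue_measure X id (cst 1) (normal_pdf 0 s) (fun x => `|x|%:E))//; last 3 first.
- exact: measurable_normal_pdf.
- by move=> x; exact: normal_pdf_ge0.
- move=> A mA; rewrite preimage_id.
  transitivity (P (X @^-1` A)); last by rewrite lawX// (negbTE s0).
  rewrite /= integral_cst ?mul1e//.
  by rewrite -[X in measurable X]setTI; exact: mX.
apply: (@le_lt_trans _ _ (\int[lebesgue_measure]_x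
    ((2 * `|s|)%:E * (normal_pdf 0 (2 * s) x)%:E))%E).
  apply: ge0_le_integral => //=.
  - by move=> x _; rewrite mule_ge0// lee_fin normal_pdf_ge0.
  - by apply: emeasurable_funM => //; apply/measurable_EFinP; exact: measurable_normal_pdf.
  - by apply: measurable_funeM; apply/measurable_EFinP; exact: measurable_normal_pdf.
  - by move=> x _; rewrite -!EFinM lee_fin normal_pdf_norm_le.
rewrite ge0_integralZl//.
- by rewrite integral_normal_pdf mule1 ltry.
- by apply/measurable_EFinP; exact: measurable_normal_pdf.
- by move=> x _; rewrite lee_fin normal_pdf_ge0.
Qed.

Lemma gaussian_pos_neg X s : gaussian P X 0 s ->
  (\int[P]_w (Num.max (X w) 0)%:E = \int[P]_w (Num.max (- X w) 0)%:E)%E.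
Proof.
move=> gX; have [mX lawX] := gX; have [mNX lawNX] := gaussianN gX.
have := @eq_integral_same_law _ _ _ P X (fun w => - X w) (fun x => (Num.max x 0)%:E).
apply => //.
- by move=> A mA; rewrite lawX// lawNX.
- by apply/measurable_EFinP; exact: measurable_maxr.
- by move=> x; rewrite lee_fin le_max lexx orbT.
Qed.

End gaussian_moment.

(** Independence makes the joint law a product, so Tonelli factors the integral. The target spaces
    are arbitrary because [X] will be the identity into [T] equipped with the sigma-algebra of
    [F]. *)
Lemma integral_indep_mul d d1 d2 (T : measurableType d) (T1 : measurableType d1)
    (T2 : measurableType d2) (R : realType) (P : probability T R)
    (X : T -> T1) (Y : T -> T2) (f : T1 -> \bar R) (g : T2 -> \bar R) :
  measurable_fun setT X -> measurable_fun setT Y ->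
  (forall A B, measurable A -> measurable B ->
    P (X @^-1` A `&` Y @^-1` B) = (P (X @^-1` A) * P (Y @^-1` B))%E) ->
  measurable_fun setT f -> measurable_fun setT g ->
  (forall x, 0 <= f x)%E -> (forall y, 0 <= g y)%E ->
  (\int[P]_w (f (X w) * g (Y w)) = \int[P]_w f (X w) * \int[P]_w g (Y w))%E.
Proof.
move=> mX mY XY mf mg f0 g0.
pose m1 := image_measure P mX; pose m2 := image_measure P mY.
pose m' := image_measure P (measurable_fun_pair mX mY).
pose h (z : T1 * T2) := (f z.1 * g z.2)%E.
have h0 z : (0 <= h z)%E by exact: mule_ge0.
have mh : measurable_fun setT h.
  apply: emeasurable_funM; apply: measurableT_comp => //.
rewrite (_ : \int[P]_w _ = \int[m']_z h z)%E; last first.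
  by rewrite [RHS]ge0_integral_pushforward//; exact: measurable_fun_pair.
rewrite (eq_measure_integral (m1 \x m2)%E); last first.
  move=> A mA _; apply/esym; apply: product_measure_unique => //.
rewrite fubini_tonelli1//.
transitivity (\int[m1]_x (f x * \int[m2]_y g y))%E.
  by apply: eq_integral => x _; rewrite /fubini_F /h/= ge0_integralZl.
rewrite ge0_integralZr//; last by apply: integral_ge0.
by congr (_ * _)%E; rewrite [LHS]ge0_integral_pushforward.
Qed.

(** * Densities as measures, and extended expectations *)

Section density_measure.
Context d (T : measurableType d) (R : realType) (P : probability T R).
Variable Z : T -> R.

(** The proof of [density P Z] is an argument so that the finite measure structure can be inferred
    from the term. *)
Definition density_measure of density P Z := fun A => (\int[P]_(w in A) (Z w)%:E)%E.

Hypothesis dZ : density P Z.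

Let density_measure0 : density_measure dZ set0 = 0%E.
Proof. by rewrite /density_measure integral_set0. Qed.

Let density_measure_ge0 A : (0 <= density_measure dZ A)%E.
Proof. by have [_ Z0 _] := dZ; apply: integral_ge0 => w _; rewrite lee_fin. Qed.

Let density_measure_sigma_additive : semi_sigma_additive (density_measure dZ).
Proof.
have [mZ Z0 _] := dZ; apply: semi_sigma_additive_nng_induced.
  exact/measurable_EFinP.
by move=> w; rewrite lee_fin.
Qed.

HB.instance Definition _ := isMeasure.Build _ _ _ (density_measure dZ)
  density_measure0 density_measure_ge0 density_measure_sigma_additive.

Let fin_num_density_measure : fin_num_fun (density_measure dZ).
Proof.
have [mZ Z0 intZ] := dZ; move=> A mA; rewrite ge0_fin_numE ?density_measure_ge0//.
apply: (@le_lt_trans _ _ 1%E); last exact: ltry.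
rewrite -intZ; apply: ge0_subset_integral => //; first exact/measurable_EFinP.
by move=> w _; rewrite lee_fin.
Qed.

HB.instance Definition _ := Measure_isFinite.Build _ _ _ (density_measure dZ)
  fin_num_density_measure.

End density_measure.

Section EQ.
Context d (T : measurableType d) (R : realType) (P : probability T R).
Implicit Types Z X : T -> R.

(** A nonnegative weight commutes with taking positive and negative parts, and both sides use the
    same convention for the difference of infinities. *)
Lemma EQE Z X : (forall w, 0 <= Z w) -> EQ P Z X = (\int[P]_w (Z w * X w)%:E)%E.
Proof.
move=> Z0; rewrite integralE /EQ; congr (_ - _)%E; apply: eq_integral => w _.
  by rewrite funeposE/= maxr_pMr// mulr0 EFin_max.
by rewrite funenegE/= maxr_pMr// mulr0 mulrN EFin_max.
Qed.

Lemma EQ_integrable Z X : density P Z -> rv X ->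
  (-oo < EQ P Z X)%E -> (-oo < EQ P Z (fun w => (- X w)%R))%E ->
  P.-integrable setT (fun w => (Z w * X w)%:E).
Proof.
move=> [mZ Z0 _] mX.
(* Since [+oo - +oo] is [-oo], a difference above [-oo] has a finite subtrahend. Applied to [X] and
   to [- X], this bounds both parts. *)
have fin2 (a b : \bar R) : (0 <= a -> 0 <= b -> -oo < a - b -> b < +oo)%E.
  by case: a b => [a||] [b||]//= *; rewrite ?ltry.
have nng Y w : (0 <= (Z w * Num.max (Y w) 0)%:E)%E.
  by rewrite lee_fin mulr_ge0// le_max lexx orbT.
have mmax Y : rv Y -> measurable_fun setT (fun w => (Z w * Num.max (Y w) 0)%:E).
  by move=> mY; apply/measurable_EFinP/measurable_funM => //; exact: measurable_maxr.
rewrite /EQ => /fin2 H1 /fin2 H2.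
have {}H1 := H1 (integral_ge0 _ (fun w _ => nng X w))
  (integral_ge0 _ (fun w _ => nng (fun w => - X w) w)).
have {}H2 := H2 (integral_ge0 _ (fun w _ => nng (fun w => - X w) w))
  (integral_ge0 _ (fun w _ => nng (fun w => - - X w) w)).
have mNX : rv (fun w => - X w) by exact: measurableT_comp.
apply/integrableP; split; first exact/measurable_EFinP/measurable_funM.
rewrite (_ : \int[P]_x _ = \int[P]_w ((Z w * Num.max (X w) 0)%:E +
   (Z w * Num.max (- X w) 0)%:E))%E; last first.
  apply: eq_integral => w _; rewrite /= -EFinD -mulrDr normrM ger0_norm//.
  congr ((_ * _)%:E); case: (lerP 0 (X w)) => h.
    by rewrite ger0_norm// max_r ?oppr_le0// addr0.
  by rewrite ltr0_norm// max_l ?oppr_ge0 1?ltW// add0r.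
rewrite ge0_integralD//; [|exact: mmax| |exact: mmax]; last first.
  by move=> w _; exact: (nng (fun w => - X w)).
rewrite lte_add_pinfty//.
by under eq_integral do rewrite -[X _]opprK.
Qed.

End EQ.

(** * Conditional expectation given the factors *)

Section conditional_expectation.
Context d (T : measurableType d) (R : realType) (P : probability T R).
Context (M : nat) (F : 'I_M -> T -> R).
Hypothesis mF : forall m, measurable_fun setT (F m).

(** The sample space with [sigma_of F] as its measurable sets: measurability with respect to [F]
    becomes ordinary measurability on this type. *)
Local Notation sT := (g_sigma_algebraType
  [set E : set T | exists m (A : set R), measurable A /\ E = F m @^-1` A]).

Lemma measurable_sigma_of E : sigma_of F E -> measurable E.
Proof.
move: E; apply: smallest_sub; first exact: sigma_algebra_measurable.
by move=> _ [m [A [mA ->]]]; rewrite -[X in measurable X]setTI; exact: mF.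
Qed.

Lemma measurable_id_sigma_of : measurable_fun setT (id : T -> sT).
Proof. by move=> _ E sE; rewrite setTI preimage_id; exact: measurable_sigma_of. Qed.

Lemma sigma_of_measurable_fun (W : T -> R) :
  (forall B : set R, measurable B -> sigma_of F (W @^-1` B)) ->
  measurable_fun setT (W : sT -> R).
Proof. by move=> mW _ B mB; rewrite setTI; exact: mW. Qed.

Lemma measurable_factor m : measurable_fun setT (F m : sT -> R).
Proof.
apply: sigma_of_measurable_fun => B mB; apply: sub_sigma_algebra.
by exists m, B.
Qed.

Lemma cond_exp_integral (Z W : T -> R) (f : sT -> \bar R) :
  density P Z -> density P W -> cond_exp P F Z W ->
  measurable_fun setT f -> (forall x, 0 <= f x)%E ->
  (\int[P]_w (f w * (Z w)%:E) = \int[P]_w (f w * (W w)%:E))%E.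
Proof.
move=> [mZ Z0 _] [mW W0 _] [_ _ WZ] mf f0.
apply: (@eq_integral_comp_weight _ _ _ T T sT R P P id id Z W f) => //;
  try exact: measurable_id_sigma_of.
by move=> E sE; rewrite !preimage_id WZ.
Qed.

(** The images under the identity into [sT] are the restrictions of [P] and of the measure with
    density [Z] to [sigma_of F]; their Radon-Nikodym derivative is the conditional expectation. *)
Lemma exists_cond_exp (Z : T -> R) : density P Z ->
  exists2 W, density P W & cond_exp P F Z W.
Proof.
move=> dZ; have [mZ Z0 intZ] := dZ.
pose mu1 := image_measure P measurable_id_sigma_of.
pose nu1 := image_measure (density_measure dZ) measurable_id_sigma_of.
have nu_mu : nu1 `<< mu1.
  apply/null_content_dominatesP => A mA muA0.
  apply: null_set_integral => //.
  - exact: measurable_sigma_of.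
  - by apply: measurable_funTS; exact/measurable_EFinP.
have [f [f0 ffin intf fE]] := radon_nikodym_sigma_finite nu_mu.
have mf : measurable_fun setT f by exact: measurable_int intf.
have fineE w : (fine (f w))%:E = f w by rewrite fineK.
have WE E : sigma_of F E ->
    (\int[P]_(w in E) (fine (f w))%:E = \int[P]_(w in E) (Z w)%:E)%E.
  move=> sE.
  have <- : (\int[mu1]_(x in E) f x = \int[P]_(w in E) (Z w)%:E)%E.
    exact/esym/(fE E sE).
  rewrite [RHS]ge0_integral_pushforward//.
  - by apply: eq_integral => w _; rewrite fineE.
  - exact: measurable_id_sigma_of.
  - exact: measurable_funTS.
have mW : measurable_fun setT (fine \o f) by exact: measurableT_comp.
have mWT : measurable_fun setT (fine \o f : T -> R).
  by move=> _ B mB; apply: measurable_sigma_of; exact: mW.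
have intW : (\int[P]_w (fine (f w))%:E = 1)%E.
  by rewrite WE//; exact: (@measurableT _ sT).
exists (fine \o f).
  by split => // w; exact: fine_ge0.
split => //.
- by move=> B mB; rewrite -[X in sigma_of F X]setTI; exact: mW.
- apply/integrableP; split; first exact/measurable_EFinP.
  under eq_integral do rewrite /= ger0_norm ?fine_ge0//.
  by rewrite intW ltry.
Qed.

(** [W] has mean 1 and is independent of [X], so weighting by [W] leaves the integrals of both parts
    of [X] unchanged; by symmetry these are equal, and they are finite. *)
Lemma indep_density_mean0 (W X : T -> R) s :
  density P W -> (forall B : set R, measurable B -> sigma_of F (W @^-1` B)) ->
  gaussian P X 0 s ->
  (forall E A, sigma_of F E -> measurable A ->
    P (E `&` X @^-1` A) = (P E * P (X @^-1` A))%E) ->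
  P.-integrable setT (fun w => (W w * X w)%:E) /\
  (\int[P]_w (W w * X w)%:E = 0)%E.
Proof.
move=> dW sW gX indep; have [mW W0 intW] := dW; have [mX _] := gX.
have mNX : rv (fun w => - X w) by exact: measurableT_comp.
have mean Y : rv Y -> (forall E A, sigma_of F E -> measurable A ->
      P (E `&` Y @^-1` A) = (P E * P (Y @^-1` A))%E) ->
    (\int[P]_w (W w * Num.max (Y w) 0)%:E = \int[P]_w (Num.max (Y w) 0)%:E)%E.
  move=> mY indepY.
  have := @integral_indep_mul _ _ _ T sT R R P id Y (EFin \o W)
    (fun y => (Num.max y 0)%:E).
  rewrite /= intW mul1e; apply => //.
  - exact: measurable_id_sigma_of.
  - by apply/measurable_EFinP; exact: sigma_of_measurable_fun.
  - by apply/measurable_EFinP; exact: measurable_maxr.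
  - by move=> x; rewrite lee_fin le_max lexx orbT.
have XN := gaussian_pos_neg gX.
have mX0 := mean X mX indep.
have mX1 : (\int[P]_w (W w * Num.max (- X w) 0)%:E =
            \int[P]_w (Num.max (- X w) 0)%:E)%E.
  apply: (mean (fun w => - X w)) => // E A sE mA.
  have mA' : measurable ((-%R : R -> R) @^-1` A).
    by rewrite -[X in measurable X]setTI; exact: (@oppr_measurable R setT).
  exact: (indep E ((-%R : R -> R) @^-1` A)).
have fin : (\int[P]_w (Num.max (- X w) 0)%:E)%E \is a fin_num.
  rewrite ge0_fin_numE; last first.
    by apply: integral_ge0 => w _; rewrite lee_fin le_max lexx orbT.
  have /integrableP[_] := gaussian_integrable gX; apply: le_lt_trans.
  apply: ge0_le_integral => //=.
  - by move=> w _; rewrite lee_fin le_max lexx orbT.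
  - by apply/measurable_EFinP; exact: measurable_maxr.
  - by apply/measurable_EFinP; exact: measurableT_comp.
  - by move=> w _; rewrite lee_fin ge_max normr_ge0 andbT ler_normr lexx orbT.
have EQ0 : EQ P W X = 0%E by rewrite /EQ mX0 mX1 XN subee.
split; last by rewrite -EQE.
apply: EQ_integrable => //; first by rewrite EQ0 ltNyr.
rewrite /EQ; under [X in (_ - X)%E]eq_integral do rewrite opprK.
by rewrite mX0 mX1 XN subee// ltNyr.
Qed.

End conditional_expectation.

(** * Real-valued means under a density *)

Section mean.
Context d (T : measurableType d) (R : realType) (P : probability T R).
Implicit Types Z X Y : T -> R.

(** Real values permit ordinary algebra; [fine] sends infinities to 0, so the value is meaningful
    only together with [mean_def]. *)
Definition mean Z X : R := fine (\int[P]_w (Z w * X w)%:E)%E.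

Definition mean_def Z X := P.-integrable setT (fun w => (Z w * X w)%:E).

Lemma EQ_mean Z X : density P Z -> mean_def Z X -> EQ P Z X = (mean Z X)%:E.
Proof.
by move=> [_ Z0 _] ZX; rewrite EQE// /mean fineK//; exact: integrable_fin_num.
Qed.

Lemma mean_defZ Z X c : mean_def Z X -> mean_def Z (fun w => c * X w).
Proof.
move=> ZX; have := integrableZl measurableT c ZX.
by congr (P.-integrable _ _); apply/funext => w; rewrite mulrCA EFinM.
Qed.

Lemma meanZ Z X c : mean_def Z X -> mean Z (fun w => c * X w) = c * mean Z X.
Proof.
move=> ZX; rewrite /mean.
under eq_integral do rewrite mulrCA EFinM.
by rewrite integralZl// fineM//; exact: integrable_fin_num.
Qed.

Lemma mean_defD Z X Y : mean_def Z X -> mean_def Z Y ->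
  mean_def Z (fun w => X w + Y w).
Proof.
move=> ZX ZY; have := integrableD measurableT ZX ZY.
by congr (P.-integrable _ _); apply/funext => w; rewrite mulrDr EFinD.
Qed.

Lemma meanD Z X Y : mean_def Z X -> mean_def Z Y ->
  mean Z (fun w => X w + Y w) = mean Z X + mean Z Y.
Proof.
move=> ZX ZY; rewrite /mean.
under eq_integral do rewrite mulrDr EFinD.
by rewrite integralD// fineD//; exact: integrable_fin_num.
Qed.

Lemma mean_def0 Z : mean_def Z (fun=> 0).
Proof.
rewrite /mean_def (_ : (fun w => _) = cst 0%E); first exact: integrable0.
by apply/funext => w; rewrite mulr0.
Qed.

Lemma mean0 Z : mean Z (fun=> 0) = 0.
Proof. by rewrite /mean; under eq_integral do rewrite mulr0; rewrite integral0. Qed.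

Lemma mean_def_sum Z (I : finType) (X : I -> T -> R) :
  (forall i, mean_def Z (X i)) -> mean_def Z (fun w => \sum_i X i w).
Proof.
move=> ZX; elim: (index_enum I) => [|i r IH].
  by under eq_fun do rewrite big_nil; exact: mean_def0.
by under eq_fun do rewrite big_cons; exact: mean_defD.
Qed.

Lemma mean_sum Z (I : finType) (X : I -> T -> R) :
  (forall i, mean_def Z (X i)) ->
  mean Z (fun w => \sum_i X i w) = \sum_i mean Z (X i).
Proof.
move=> ZX; pose p r := mean_def Z (fun w => \sum_(i <- r) X i w) /\
  mean Z (fun w => \sum_(i <- r) X i w) = \sum_(i <- r) mean Z (X i).
suff : p (index_enum I) by case.
elim: (index_enum I) => [|i r [IHd IH]]; rewrite /p.
  rewrite big_nil; under eq_fun do rewrite big_nil.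
  by split; [exact: mean_def0|exact: mean0].
rewrite big_cons; under eq_fun do rewrite big_cons.
by split; [exact: mean_defD|rewrite meanD// IH].
Qed.

Lemma mean_lincomb Z (I : finType) (F : I -> T -> R) (c : I -> R) :
  (forall i, mean_def Z (F i)) ->
  mean_def Z (fun w => \sum_i c i * F i w) /\
  mean Z (fun w => \sum_i c i * F i w) = \sum_i c i * mean Z (F i).
Proof.
move=> ZF; have ZcF i : mean_def Z (fun w => c i * F i w) by exact: mean_defZ.
split; first exact: mean_def_sum.
by rewrite mean_sum//; apply: eq_bigr => i _; rewrite meanZ.
Qed.

(** The bound does not involve [V], so it is uniform over any family sharing the constants [C] and
    [e]; it serves the determining set and the conditional densities alike. *)
Lemma mean_perturbed (I : finType) (V : T -> R) (F : I -> T -> R) (eta : T -> R)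
    (beta b C : I -> R) (a e : R) :
  (forall i, mean_def V (F i)) -> (forall i, `|mean V (F i)| <= C i) ->
  mean_def V eta -> `|mean V eta| <= e ->
  mean_def V (fun w => \sum_i beta i * F i w + eta w) /\
  `|mean V (fun w => \sum_i beta i * F i w + eta w) -
    a * mean V (fun w => \sum_i b i * F i w)| <=
  \sum_i `|beta i - a * b i| * C i + e.
Proof.
move=> VF VC Veta etae.
have [Vbeta Ebeta] := mean_lincomb beta VF.
have [Vb Eb] := mean_lincomb b VF.
split; first exact: mean_defD.
rewrite meanD// Ebeta Eb addrAC mulr_sumr -sumrB.
apply: (le_trans (ler_normD _ _)); rewrite lerD//.
apply: (le_trans (ler_norm_sum _ _ _)); apply: ler_sum => i _.
by rewrite mulrA -mulrBl normrM ler_wpM2l.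
Qed.

(** Covers degenerate noise, which cannot be rescaled to unit variance: [X] vanishes almost surely,
    hence so does its product with [Z]. *)
Lemma mean_def_null Z X : measurable_fun setT Z -> gaussian P X 0 0 ->
  mean_def Z X /\ mean Z X = 0.
Proof.
move=> mZ [mX lawX].
have ZX0 : ae_eq P setT (fun w => (Z w * X w)%:E) (cst 0%E).
  have P0 : P (X @^-1` [set~ 0]) = 0.
    rewrite lawX; last exact: measurableC.
    by rewrite eqxx diracE memNset//= => /(_ erefl).
  exists (X @^-1` [set~ 0]); split => //.
    by rewrite -[X in measurable X]setTI; apply: mX => //; exact: measurableC.
  move=> w /= h X0; apply: h => _.
  by rewrite X0 mulr0.
have mZX : measurable_fun setT (fun w => (Z w * X w)%:E).
  by apply/measurable_EFinP; exact: measurable_funM.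
split.
  apply/integrableP; split => //.
  by have [_ ->] := ae_eq_integral_abs P measurableT mZX; rewrite ?ltry.
by rewrite /mean (ae_eq_integral (cst 0%E))// integral0.
Qed.

End mean.

(** * Uniform bounds over the determining set *)

Section utility.
Context d (T : measurableType d) (R : realType) (P : probability T R).
Variable u : (T -> R) -> \bar R.
Hypothesis cu : coherent_utility P u.
Local Notation D := (determining_set P u).

(** The determining set contains any representing set, so its infimum is no larger; it is no smaller
    by the defining inequality. *)
Lemma utilityE X : rv X -> u X = inf_over P D X.
Proof.
move=> mX; apply/eqP; rewrite eq_le; apply/andP; split.
  by apply: le_ereal_inf_tmp => _ [Z [_ uZ] <-]; exact: uZ.
have [D0 [D0d _ uE]] := cu.
rewrite [X in (_ <= X)%E]uE//; apply: le_ereal_inf_tmp => _ [Z D0Z <-].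
apply: ereal_inf_lbound; exists Z => //.
split; first exact: D0d.
by move=> Y mY; rewrite uE//; apply: ereal_inf_lbound; exists Z.
Qed.

(** Every mean over the determining set lies between [u X] and the opposite of [u (- X)]. *)
Lemma L1w_mean X : L1w u X -> exists C : R, forall Z, D Z ->
  mean_def P Z X /\ `|mean P Z X| <= C.
Proof.
move=> [mX [uX uNX]].
have mNX : rv (fun w => - X w) by exact: measurableT_comp.
exists (Num.max (- fine (u X)) (- fine (u (fun w => - X w)))) => Z [dZ uZ].
have ZX : mean_def P Z X.
  by apply: EQ_integrable => //; [exact: lt_le_trans (uZ _ _)|exact: lt_le_trans (uZ _ _)].
have NE : (fun w => - X w) = (fun w => -1 * X w) by apply/funext => w; rewrite mulN1r.
have ZNX : mean_def P Z (fun w => - X w) by rewrite NE; exact: mean_defZ.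
split => //.
have := uZ _ mX; have := uZ _ mNX; rewrite !EQ_mean// [X in mean P Z X]NE meanZ// mulN1r.
move: uX uNX; case: (u X) => [r||]//; case: (u _) => [r'||]//= _ _.
rewrite !lee_fin => h1 h2; rewrite le_max !ler_norml.
by case: (lerP 0 (mean P Z X)) => h; apply/orP; [right|left]; apply/andP; split; lra.
Qed.

Hypothesis lu : law_invariant P u.
Hypothesis fu : finite_on_gaussians P u.

Lemma gaussian_mean : exists2 g : R, 0 <= g & forall Z, D Z ->
  forall eta (s : R), 0 <= s -> gaussian P eta 0 s ->
  mean_def P Z eta /\ `|mean P Z eta| <= g * s.
Proof.
(* The probability space may carry no standard Gaussian. Rescaling any nondegenerate centred
   Gaussian would produce one, so all are then degenerate and [g = 0] works. *)
have [[G0 gG0]|noG] := pselect (exists G, gaussian P G 0 1); last first.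
  exists 0 => // Z [[mZ _ _] _] eta s s0 geta.
  have [s1|s1] := eqVneq s 0.
    rewrite s1 in geta; have [? ->] := mean_def_null mZ geta.
    by rewrite normr0 mul0r.
  exfalso; apply: noG; exists (fun w => s^-1 * eta w).
  by apply: gaussian_normalize => //; rewrite lt_neqAle eq_sym s1.
have lw G : gaussian P G 0 1 -> u G = u G0.
  move=> [mG lG]; have [mG0 lG0] := gG0; apply: lu => // A mA.
  by rewrite lG// lG0.
have L1wG0 : L1w u G0.
  have := fu gG0; have := fu (gaussianN gG0).
  rewrite !fin_numE => /andP[h _] /andP[h' _].
  by split; [case: gG0|split; rewrite ltNye].
exists `|fine (u G0)| => // Z DZ eta s s0 geta.
have [dZ uZ] := DZ; have [mZ _ _] := dZ.
have [s1|s1] := eqVneq s 0.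
  rewrite s1 in geta; have [? ->] := mean_def_null mZ geta.
  by split => //; rewrite normr0 mulr_ge0.
have sgt0 : 0 < s by rewrite lt_neqAle eq_sym s1.
pose G w := s^-1 * eta w.
have gG : gaussian P G 0 1 by exact: gaussian_normalize.
(* [G] and [- G] both have the law of [G0], so [u G0] is a lower bound for the mean of [G] and for
   its opposite. *)
have [mG _] := gG; have gNG := gaussianN gG; have [mNG _] := gNG.
have uf : u G0 \is a fin_num by exact: fu gG0.
have L1wG : L1w u G.
  split=> //; rewrite (lw _ gG) (lw _ gNG).
  by case: (u G0) uf => //= r _; rewrite ltNyr.
have [C /(_ Z DZ) [ZG _]] := L1w_mean L1wG.
have etaE : eta = (fun w => s * G w).
  by apply/funext => w; rewrite /G mulrA mulfV// mul1r.
rewrite etaE; split; first exact: mean_defZ.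
rewrite meanZ// normrM gtr0_norm// mulrC ler_wpM2r//.
have NE : (fun w => - G w) = (fun w => -1 * G w) by apply/funext => w; rewrite mulN1r.
have ZNG : mean_def P Z (fun w => - G w) by rewrite NE; exact: mean_defZ.
have := uZ _ mG; have := uZ _ mNG; rewrite (lw _ gG) (lw _ gNG) !EQ_mean//.
rewrite [X in mean P Z X]NE meanZ// mulN1r.
case: (u G0) uf => //= r _; rewrite !lee_fin ler_norml => h1 h2.
by have := ler_norm (- r); rewrite normrN => h3; apply/andP; split; lra.
Qed.

End utility.

(** * Perturbation of infima, and limits *)

Lemma ereal_inf_perturb (R : realType) (I : Type) (A : set I) (f g : I -> R)
    (c e L : R) : 0 < c ->
  (forall i, A i -> `|f i - c * g i| <= e) ->
  ereal_inf [set (g i)%:E | i in A] = L%:E ->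
  exists2 l, ereal_inf [set (f i)%:E | i in A] = l%:E & `|l - c * L| <= e.
Proof.
move=> c0 fg gL.
have lower : ((c * L - e)%:E <= ereal_inf [set (f i)%:E | i in A])%E.
  apply: le_ereal_inf_tmp => _ [i Ai <-]; rewrite lee_fin.
  have : (L%:E <= (g i)%:E)%E by rewrite -gL; apply: ereal_inf_lbound; exists i.
  rewrite lee_fin => /(ler_wpM2l (ltW c0)) h.
  by have := fg i Ai; rewrite ler_norml => /andP[? ?]; lra.
have upper : (ereal_inf [set (f i)%:E | i in A] <= (c * L + e)%:E)%E.
  apply/lee_addgt0Pr => t t0.
  (* An index within [t / c] of the infimum [L] is within [t] of [c * L] after scaling. *)
  have /lb_ereal_inf_adherent : 0 < t / c by exact: divr_gt0.
  move=> /(_ [set (g i)%:E | i in A]); rewrite gL => /(_ isT) [_ [i Ai <-]].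
  rewrite -EFinD lte_fin => h.
  apply: (@le_trans _ _ (f i)%:E); first by apply: ereal_inf_lbound; exists i.
  rewrite -EFinD lee_fin; have := fg i Ai; rewrite ler_norml => /andP[_ h1].
  have h2 : c * g i <= c * L + t.
    rewrite -ler_pdivlMl// mulrDr mulKf ?gt_eqF// [_^-1 * t]mulrC; exact: ltW.
  lra.
case: (ereal_inf _) lower upper => [l||]//; rewrite !lee_fin => h1 h2.
by exists l => //; rewrite ler_norml; apply/andP; split; lra.
Qed.

Lemma cvg_dist_le (R : realType) (x e : nat -> R) (l : R) :
  (\forall n \near \oo, `|x n - l| <= e n) -> e n @[n --> \oo] --> 0 ->
  x n @[n --> \oo] --> l.
Proof.
move=> xe /cvgrPdist_le e0; apply/cvgrPdist_le => t t0.
have := e0 t t0; apply: filterS2 xe => n; rewrite distrC sub0r normrN => h1 h2.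
by apply: (le_trans h1); apply: le_trans h2; exact: ler_norm.
Qed.

Lemma cvg_sum0 (R : realType) (I : finType) (f : I -> nat -> R) :
  (forall i, f i n @[n --> \oo] --> 0) -> \sum_i f i n @[n --> \oo] --> 0.
Proof.
move=> f0; elim: (index_enum I) => [|i r IH].
  by under eq_fun do rewrite big_nil; exact: cvg_cst.
under eq_fun do rewrite big_cons.
have : f i n + \sum_(j <- r) f j n @[n --> \oo] --> (0 + 0 : R).
  by apply: cvgD; [exact: f0|exact: IH].
by rewrite addr0.
Qed.

(** * Factors and noises under conditional densities *)

Section factor.
Context d (T : measurableType d) (R : realType) (P : probability T R).
Context (M : nat) (F : 'I_M -> T -> R).
Hypothesis mF : forall m, measurable_fun setT (F m).

Local Notation sT := (g_sigma_algebraType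
  [set E : set T | exists m (A : set R), measurable A /\ E = F m @^-1` A]).

(** Stated for extended expectations, so no integrability is presupposed; [cond_exp_mean] uses it
    for [F m] and [- F m] to transfer integrability from [Z] to [W]. *)
Lemma cond_exp_EQ Z W X : density P Z -> density P W -> cond_exp P F Z W ->
  measurable_fun setT (X : sT -> R) -> EQ P W X = EQ P Z X.
Proof.
move=> dZ dW ZW mX.
have eqmax Y : measurable_fun setT (Y : sT -> R) ->
   (\int[P]_w (W w * Num.max (Y w) 0)%:E = \int[P]_w (Z w * Num.max (Y w) 0)%:E)%E.
  move=> mY; under eq_integral do rewrite mulrC EFinM.
  under [RHS]eq_integral do rewrite mulrC EFinM.
  apply/esym; apply: (cond_exp_integral mF (f := fun w => (Num.max (Y w) 0)%:E)) => //.
    by apply/measurable_EFinP; exact: measurable_maxr.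
  by move=> w; rewrite lee_fin le_max lexx orbT.
rewrite /EQ; congr (_ - _)%E; first exact: eqmax.
by apply: (eqmax (fun w => - X w)); exact: measurableT_comp.
Qed.

Lemma cond_exp_mean Z W m : density P Z -> density P W -> cond_exp P F Z W ->
  mean_def P Z (F m) -> mean_def P W (F m) /\ mean P W (F m) = mean P Z (F m).
Proof.
move=> dZ dW ZW ZX; have sF := @measurable_factor _ T R M F m.
have EF := cond_exp_EQ dZ dW ZW sF.
have NE : (fun w => - F m w) = (fun w => -1 * F m w).
  by apply/funext => w; rewrite mulN1r.
have EN : EQ P W (fun w => - F m w) = EQ P Z (fun w => - F m w).
  by apply: (cond_exp_EQ dZ dW ZW); exact: measurableT_comp.
have WX : mean_def P W (F m).
  apply: EQ_integrable => //; first exact: mF.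
    by rewrite EF EQ_mean// ltNyr.
  rewrite EN [X in EQ P Z X]NE EQ_mean ?ltNyr//; exact: mean_defZ.
by split => //; move: EF; rewrite !EQ_mean// => -[].
Qed.

Lemma indep_family_event n (xi : nat -> T -> R) k E A :
  indep_family_vec P n xi F -> (k < n)%N -> sigma_of F E -> measurable A ->
  P (E `&` xi k @^-1` A) = (P E * P (xi k @^-1` A))%E.
Proof.
move=> indep kn sE mA; pose B j := if j == k then A else setT.
have Bk : B k = A by rewrite /B eqxx.
have := indep E B sE; rewrite (bigD1 (Ordinal kn))//= Bk big1 ?mule1; last first.
  move=> j; rewrite -val_eqE/= /B => /negbTE ->.
  by rewrite preimage_setT probability_setT.
move=> <-; last by move=> j _; rewrite /B; case: ifP.
congr (P (_ `&` _)); apply/seteqP; split => [w Aw j _|w]; last first.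
  by move=> /(_ k kn); rewrite /B eqxx.
by rewrite /B; case: eqVneq => [->|].
Qed.

Lemma indep_family_gaussian n (xi : nat -> T -> R) (sigma : nat -> R) :
  indep_family_vec P n xi F ->
  (forall k, (k < n)%N -> gaussian P (xi k) 0 (sigma k)) ->
  gaussian P (fun w => \sum_(k < n) xi k w) 0 (Num.sqrt (\sum_(k < n) sigma k ^+ 2)).
Proof.
move=> indep gxi; apply: gaussian_sum => // A mA.
have := indep setT A (@measurableT _ sT) mA.
by rewrite setTI probability_setT mul1e.
Qed.

Lemma cond_mean_noise n (xi : nat -> T -> R) (sigma : nat -> R) Z W :
  indep_family_vec P n xi F ->
  (forall k, (k < n)%N -> gaussian P (xi k) 0 (sigma k)) ->
  density P W -> cond_exp P F Z W ->
  mean_def P W (fun w => \sum_(k < n) xi k w) /\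
  mean P W (fun w => \sum_(k < n) xi k w) = 0.
Proof.
move=> indep gxi dW [sW _ _].
have H (k : 'I_n) : mean_def P W (xi k) /\ mean P W (xi k) = 0.
  have [|Wxi Exi] := indep_density_mean0 mF dW sW (gxi k (ltn_ord k)).
    by move=> E A sE mA; exact: (indep_family_event indep).
  by split => //; rewrite /mean Exi.
have Wxi (k : 'I_n) : mean_def P W (xi k) by case: (H k).
split; first exact: (mean_def_sum (X := fun k : 'I_n => xi k)).
rewrite (mean_sum (X := fun k : 'I_n => xi k))// big1// => k _.
by case: (H k).
Qed.

End factor.

(** * Limit of the ratio of the two utilities *)

Unset Implicit Arguments.
Theorem theorem3p9 (R : realType) (d : measure_display) (Omega : measurableType d)
  (P : probability Omega R) (u : (Omega -> R) -> \bar R)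
  (M : nat) (F : 'I_M -> Omega -> R)
  (B : nat -> nat -> 'I_M -> R) (sigma : nat -> nat -> R)
  (xi : nat -> nat -> Omega -> R) (a : nat -> R) (b : 'I_M -> R) :
  coherent_utility P u ->
  law_invariant P u ->
  finite_on_gaussians P u ->
  (forall m, L1w u (F m)) ->
  (forall c : 'I_M -> R, (exists m, c m != 0) ->
     (u (fun w => (\sum_(m < M) c m * F m w)%R) < 0)%E) ->
  (forall n, indep_family_vec P n (xi n) F) ->
  (forall n k, (k < n)%N -> gaussian P (xi n k) 0 (sigma n k)) ->
  a n @[n --> \oo] --> +oo ->
  (exists m, b m != 0) ->
  (forall m, (a n)^-1 * \sum_(k < n) B n k m @[n --> \oo] --> b m) ->
  (a n)^-2 * \sum_(k < n) (sigma n k) ^+ 2 @[n --> \oo] --> 0 ->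
  let S n := fun w => \sum_(k < n) (\sum_(m < M) B n k m * F m w + xi n k w) in
  (\forall n \near \oo,
      u (S n) \is a fin_num /\ factor_utility P u F (S n) \is a fin_num) /\
  fine (factor_utility P u F (S n)) / fine (u (S n)) @[n --> \oo] --> (1 : R).
Proof.
move=> cu lu fu L1wF uneg indep gxi a_oo bneq0 Bb sig0 S.
have mF m : measurable_fun setT (F m) by case: (L1wF m).
pose D := determining_set P u.
have Dd Z : D Z -> density P Z by case.
have [C HC] := choice (fun m => L1w_mean P (L1wF m)).
have DF Z m : D Z -> mean_def P Z (F m) by move=> DZ; case: (HC m Z DZ).
have DC Z m : D Z -> `|mean P Z (F m)| <= C m by move=> DZ; case: (HC m Z DZ).
have [g g0 Hg] := gaussian_mean lu fu.
pose bF w := \sum_(m < M) b m * F m w.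
have mbF : rv bF by apply: measurable_sum => m; exact: measurable_funM.
have DbF Z : D Z -> mean_def P Z bF.
  by move=> DZ; have [] := mean_lincomb b (fun m => DF Z m DZ).
have infE (A : set (Omega -> R)) X : A `<=` density P ->
    (forall Z, A Z -> mean_def P Z X) ->
    inf_over P A X = ereal_inf [set (mean P Z X)%:E | Z in A].
  move=> Ad AX; congr ereal_inf; apply: eq_imagel => Z AZ.
  by rewrite EQ_mean//; [exact: Ad|exact: AX].
(* The constants [C m] bound the means of [bF] from below and negativity excludes [+oo], so [L] is
   real and nonzero, as the final quotient requires. *)
have [L [uL L0]] : exists L, u bF = L%:E /\ L < 0.
  have := uneg b bneq0; rewrite -/bF.
  have : ((- \sum_(m < M) `|b m| * C m)%:E <= u bF)%E.
    rewrite (utilityE cu mbF) infE//; apply: le_ereal_inf_tmp => _ [Z DZ <-].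
    rewrite lee_fin; have [_ ->] := mean_lincomb b (fun m => DF Z m DZ).
    rewrite lerNl; apply: (le_trans (ler_norm _)); rewrite normrN.
    apply: (le_trans (ler_norm_sum _ _ _)); apply: ler_sum => m _.
    by rewrite normrM ler_wpM2l// DC.
  by case: (u bF) => [L||]// _; rewrite lte_fin => L0; exists L.
pose W0 := cond_set P D F.
have W0d : W0 `<=` density P by move=> W [].
have W0F W m : W0 W -> mean_def P W (F m) /\ `|mean P W (F m)| <= C m.
  move=> [dW [Z DZ ZW]].
  have [WF ->] := cond_exp_mean mF (Dd Z DZ) dW ZW (DF Z m DZ).
  by split => //; exact: DC.
have infD : ereal_inf [set (mean P Z bF)%:E | Z in D] = L%:E.
  by rewrite -uL (utilityE cu mbF) infE.
(* Both families produce the same set of means of [bF]; [exists_cond_exp] gives the inclusion that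
   starts from [D]. *)
have infW0 : ereal_inf [set (mean P W bF)%:E | W in W0] = L%:E.
  have meanE Z W : D Z -> density P W -> cond_exp P F Z W ->
      mean P W bF = mean P Z bF.
    move=> DZ dW ZW; have HW m := cond_exp_mean mF (Dd Z DZ) dW ZW (DF Z m DZ).
    have [_ ->] := mean_lincomb b (fun m => (HW m).1).
    have [_ ->] := mean_lincomb b (fun m => DF Z m DZ).
    by apply: eq_bigr => m _; rewrite (HW m).2.
  rewrite -infD; congr ereal_inf; apply/seteqP.
  split=> [_ [V [dW [Z DZ ZW]] <-]|_ [V DV <-]].
    by exists Z => //; rewrite (meanE Z V).
  have [W dW VW] := exists_cond_exp mF (Dd V DV).
  by exists W; [split => //; exists V|rewrite (meanE V W)].
pose beta n m := \sum_(k < n) B n k m.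
pose s n := Num.sqrt (\sum_(k < n) sigma n k ^+ 2).
pose eta n w := \sum_(k < n) xi n k w.
have SE n : S n = (fun w => \sum_(m < M) beta n m * F m w + eta n w).
  apply/funext => w; rewrite /S big_split/=; congr (_ + _).
  by rewrite exchange_big/=; apply: eq_bigr => m _; rewrite mulr_suml.
have geta n : gaussian P (eta n) 0 (s n).
  exact: (indep_family_gaussian (indep n) (gxi n)).
have mS n : rv (S n).
  rewrite SE; apply: measurable_funD; last by case: (geta n).
  by apply: measurable_sum => m; exact: measurable_funM.
pose err n := \sum_(m < M) `|beta n m - a n * b m| * C m + g * s n.
have estimate n : 0 < a n ->
    (exists2 x, u (S n) = x%:E & `|x - a n * L| <= err n) /\
    (exists2 y, factor_utility P u F (S n) = y%:E & `|y - a n * L| <= err n).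
  move=> an0; split.
    have H Z : D Z -> mean_def P Z (S n) /\
        `|mean P Z (S n) - a n * mean P Z bF| <= err n.
      move=> DZ; rewrite SE; have [Zeta Ze] := Hg Z DZ _ _ (sqrtr_ge0 _) (geta n).
      by apply: mean_perturbed => // m; [exact: DF|exact: DC].
    rewrite (utilityE cu (mS n)) infE//; last by move=> Z /H[].
    by apply: (ereal_inf_perturb an0 _ infD) => Z /H[].
  have H W : W0 W -> mean_def P W (S n) /\
      `|mean P W (S n) - a n * mean P W bF| <= err n.
    move=> WW; have [dW [Z DZ ZW]] := WW; rewrite SE.
    have [Weta We] := cond_mean_noise mF (indep n) (gxi n) dW ZW.
    apply: mean_perturbed => //; try by move=> m; case: (W0F W m WW).
    (* The noise mean is exactly 0 here and is bounded by [g * s n] only to share [err n] with the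
       other family. *)
    by rewrite We normr0 mulr_ge0// sqrtr_ge0.
  rewrite /factor_utility infE//; last by move=> W /H[].
  by apply: (ereal_inf_perturb an0 _ infW0) => W /H[].
have a_pos : \forall n \near \oo, 0 < a n.
  by move/cvgryPgt : a_oo; apply.
split.
  apply: filterS a_pos => n /estimate[[x -> _] [y -> _]].
  by [].
(* This is [err n / a n] when [a n] is positive, written so that the two convergence assumptions
   apply verbatim; the factor [a n] enters the root as [(a n)^-2]. *)
pose dlt n := \sum_(m < M) `|(a n)^-1 * beta n m - b m| * C m +
  g * Num.sqrt ((a n)^-2 * \sum_(k < n) sigma n k ^+ 2).
have dlt0 : dlt n @[n --> \oo] --> 0.
  have h1 : \sum_(m < M) `|(a n)^-1 * beta n m - b m| * C m @[n --> \oo] --> 0.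
    apply: cvg_sum0 => m.
    have h : `|(a n)^-1 * beta n m - b m| @[n --> \oo] --> (0 : R).
      have : `|(a n)^-1 * beta n m - b m| @[n --> \oo] --> `|b m - b m|.
        by apply: cvg_norm; apply: cvgB; [exact: Bb|exact: cvg_cst].
      by rewrite subrr normr0.
    have : `|(a n)^-1 * beta n m - b m| * C m @[n --> \oo] --> 0 * C m.
      by apply: cvgM => //; exact: cvg_cst.
    by rewrite mul0r.
  have h2 : Num.sqrt ((a n)^-2 * \sum_(k < n) sigma n k ^+ 2) @[n --> \oo]
      --> (0 : R).
    have : Num.sqrt ((a n)^-2 * \sum_(k < n) sigma n k ^+ 2) @[n --> \oo]
        --> Num.sqrt (0 : R).
      by apply: continuous_cvg => //; exact: sqrt_continuous.
    by rewrite sqrtr0.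
  have : dlt n @[n --> \oo] --> 0 + g * 0.
    by apply: cvgD => //; apply: cvgM => //; exact: cvg_cst.
  by rewrite mulr0 addr0.
have errE n : 0 < a n -> (a n)^-1 * err n = dlt n.
  move=> an0; have an0' : a n != 0 by rewrite gt_eqF.
  rewrite /err /dlt mulrDr mulr_sumr; congr (_ + _).
    apply: eq_bigr => m _; rewrite mulrA; congr (_ * _).
    rewrite -{1}[(a n)^-1]gtr0_norm ?invr_gt0// -normrM mulrBr mulKf//.
  rewrite mulrCA; congr (_ * _).
  by rewrite sqrtrM ?invr_ge0 ?sqr_ge0// -exprVn sqrtr_sqr gtr0_norm ?invr_gt0.
have lim (x : nat -> \bar R) :
    (forall n, 0 < a n -> exists2 r, x n = r%:E & `|r - a n * L| <= err n) ->
    (a n)^-1 * fine (x n) @[n --> \oo] --> L.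
  move=> Hx; apply: (cvg_dist_le (e := dlt)) => //.
  apply: filterS a_pos => n an0; have [r -> hr] := Hx n an0.
  have an0' : a n != 0 by rewrite gt_eqF.
  rewrite -(errE n an0) /= -{1}[L](mulKf an0').
  by rewrite -mulrBr normrM gtr0_norm ?invr_gt0// ler_wpM2l// invr_ge0 ltW.
have lim_u := lim (fun n => u (S n)) (fun n an0 => (estimate n an0).1).
have lim_f := lim (fun n => factor_utility P u F (S n))
  (fun n an0 => (estimate n an0).2).
have Ln0 : L != 0 by rewrite lt_eqF.
(* Numerator and denominator are both divided by [a n], which cancels once [a n] is positive. *)
have ratio : (a n)^-1 * fine (factor_utility P u F (S n)) /
    ((a n)^-1 * fine (u (S n))) @[n --> \oo] --> L / L.
  by apply: cvgM; [exact: lim_f|exact: cvgV lim_u].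
rewrite -[X in _ --> X](mulfV Ln0); apply: cvg_trans ratio; apply: near_eq_cvg.
apply: filterS a_pos => n an0 /=.
by rewrite invfM invrK mulrACA mulVf ?mul1r// gt_eqF.
Qed.
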